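(* For each $n\ge 1$ there exists a Boolean network $f$ whose interaction graph $G(f)$ admits a path of length $n$ all of whose vertices have indegree one and outdegree one in $G(f)$, such that the network $\tilde f$ obtained from $f$ by eliminating any one of the variables in this path satisfies $A(\tilde f)>A(f)$.
   Context: $\mathbb{B}=\{0,1\}$. A Boolean network is a map $f\colon\mathbb{B}^n\to\mathbb{B}^n$ with components $V$. $\bar{x}^i$ denotes $x$ with component $i$ flipped; $x^{i=a}$ denotes $x$ with component $i$ set to $a$. The asynchronous dynamics $AD(f)$ is the directed graph on the states with a transition $x\to\bar{x}^i$ iff $f_i(x)\neq x_i$. The interaction graph $G(f)$ is the signed multidigraph on $V$ with an edge $j\to i$ of sign $s\in\{-1,1\}$ iff $s=(f_i(\bar{x}^j)-f_i(x))(\bar{x}^j_j-x_j)$ for some state $x$; indegree/outdegree are counted in $G(f)$. A trap set is a set of states closed under transitions; attractors are minimal nonempty trap sets; an attractor is a fixed point if it has one state and cyclic otherwise. $S(f)$ denotes the number of fixed points and $A(f)$ the number of cyclic attractors of $AD(f)$. Elimination of a variable $v$ with no positive loop at $v$ in $G(f)$: for $a\in\{0,1\}$, $\mathcal{R}^a(x)$ is $x$ with component $v$ replaced by $f_v(x^{v=a})$; $\pi$ is the projection onto the components $V\setminus\{v\}$; $\mathcal{S}^a$ is the unique map with $\mathcal{S}^a\circ\pi=\mathcal{R}^a$; $\tilde f_i(x)=f_i(\mathcal{S}^0(x))\wedge f_i(\mathcal{S}^1(x))$ if $x_i=1$ and $\tilde f_i(x)=f_i(\mathcal{S}^0(x))\vee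 f_i(\mathcal{S}^1(x))$ if $x_i=0$, for $i\neq v$. (A vertex with indegree one whose unique regulator is another vertex has no loop, so it can be eliminated; then $\tilde f$ is obtained by substituting $f_v$ for $x_v$.) *)

(* Defs.v *)
From HB Require Import structures.
From mathcomp Require Import all_boot all_order all_algebra.

Set Implicit Arguments.
Unset Strict Implicit.
Unset Printing Implicit Defensive.

Import GRing.Theory.

(* Boolean networks are indexed by an arbitrary finite type of components, so  *)
(* that a network on V \ {v} is again a network.                               *)

Definition state (V : finType) := {ffun V -> bool}.

Definition network (V : finType) := state V -> state V.

Definition setc (V : finType) (x : state V) (i : V) (a : bool) : state V :=
  [ffun j => if j == i then a else x j].

Definition flip (V : finType) (x : state V) (i : V) : state V :=
  setc x i (~~ x i).

Section Dynamics.

Variables (V : finType) (f : network V).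

Definition transition : rel (state V) :=
  fun x y => [exists i, (f x i != x i) && (y == flip x i)].

Definition trap_set (A : {set state V}) : bool :=
  [forall x in A, forall y, transition x y ==> (y \in A)].

Definition attractor (A : {set state V}) : bool :=
  minset (fun B : {set state V} => (B != set0) && trap_set B) A.

Definition cyclic_attractor (A : {set state V}) : bool :=
  attractor A && (#|A| != 1).

Definition num_cyclic_attractors : nat :=
  #|[set A : {set state V} | cyclic_attractor A]|.

End Dynamics.

Section InteractionGraph.

Variables (V : finType) (f : network V).

(* The triple (j, s, i) is the edge j -> i of sign (-1) ^+ s, so s = false     *)
(* encodes a positive edge and s = true a negative one.                        *)
Definition interaction_graph : {set V * bool * V} :=
  [set e : V * bool * V | let: (j, s, i) := e in
    [exists x : state V,
      ((-1) ^+ s == ((f (flip x j) i)%:Z - (f x i)%:Z)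
                    * ((flip x j j)%:Z - (x j)%:Z) :> int)%R]].

(* Parallel edges of opposite signs are counted separately.                    *)
Definition indegree (i : V) : nat :=
  #|[set e in interaction_graph | e.2 == i]|.

Definition outdegree (j : V) : nat :=
  #|[set e in interaction_graph | e.1.1 == j]|.

Definition arc : rel V :=
  fun j i => [exists s : bool, (j, s, i) \in interaction_graph].

Definition positive_loop (v : V) : bool :=
  (v, false, v) \in interaction_graph.

(* v :: p is a path of length n, i.e. with n edges and n + 1 distinct vertices. *)
Definition is_graph_path (n : nat) (v : V) (p : seq V) : bool :=
  [&& size p == n, path arc v p & uniq (v :: p)].

End InteractionGraph.

Section Elimination.

Variables (V : finType) (f : network V) (v : V).

Definition remaining : finType := {i : V | i != v}.

Definition proj (x : state V) : state remaining :=
  [ffun i : remaining => x (val i)].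

Definition replace (a : bool) (x : state V) : state V :=
  setc x v (f (setc x v a) v).

Definition extend (a : bool) (y : state remaining) : state V :=
  [ffun i => if insub i is Some u then y u else a].

(* replace a x does not depend on x v, so any extension of y may be used.      *)
Definition lift_state (a : bool) (y : state remaining) : state V :=
  replace a (extend a y).

Definition eliminate : network remaining := fun y =>
  [ffun i : remaining =>
     if y i then f (lift_state false y) (val i) && f (lift_state true y) (val i)
     else f (lift_state false y) (val i) || f (lift_state true y) (val i)].

Lemma extendK (a : bool) : cancel (extend a) proj.
Proof. by move=> y; apply/ffunP => i; rewrite !ffunE valK. Qed.

Lemma lift_state_proj (a : bool) (x : state V) :
  lift_state a (proj x) = replace a x.
Proof.
have eq_setc b : setc (extend a (proj x)) v b = setc x v b.
  apply/ffunP => i; rewrite !ffunE; case: (eqVneq i v) => // iv.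
  by rewrite insubT !ffunE.
by rewrite /lift_state /replace !eq_setc.
Qed.

Lemma lift_state_unique (a : bool) (S : state remaining -> state V) :
  (forall x, S (proj x) = replace a x) -> S =1 lift_state a.
Proof. by move=> SE y; rewrite -[y](extendK a) SE lift_state_proj. Qed.

End Elimination.

Arguments eliminate {V} f v y.

(* Main.v *)
(* A source u feeds a chain of m - 1 delays, which feeds a visible register of *)
(* m + 1 vertices, each copying its left neighbour. The source toggles freely   *)
(* as long as the register is constant and is frozen otherwise; the register    *)
(* freezes for ever once it alternates fully, i.e. m times. While u is frozen,  *)
(* copying cannot increase the number of alternations of the whole word, and    *)
(* while the register is constant this number is at most the number of edges    *)
(* from u through the chain to the register: m, which is just enough to freeze  *)
(* the register and reach a fixed point, so that there is no cyclic attractor.  *)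
(* Eliminating one delay lowers the bound to m - 1, and then the words with     *)
(* fewer than m alternations form a trap set without fixed points.              *)
Require Import Defs.
From mathcomp Require Import all_boot all_order all_algebra.
From mathcomp Require Import zify.

Set Implicit Arguments.
Unset Strict Implicit.
Unset Printing Implicit Defensive.

(** Read a state as a binary word of length 2m + 1 and count its alternations. In [delay_network]
    every word reaches a fixed point ([reach_all]): flood it with the source value, load m
    alternations into the source and chain while the register stays constant, then shift them into
    the register, which locks. Hence there is no cyclic attractor ([num_cyclic_attractors_eq0]).

    After elimination of a chain vertex v, the lifted word always repeats at v the letter of v - 1,
    so a word with constant register has at most m - 1 alternations. Thus [few_alternations] is a
    trap set. It contains no fixed point: with an unlocked register, a fixed word is constant, and
    then the source is unstable. So it contains a cyclic attractor ([num_cyclic_attractors_gt0]).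
    The degrees come from [mem_delay_graph]. *)

(** * Attractors and reachability in arbitrary networks *)

Section GeneralDynamics.

Variables (V : finType) (f : network V).

Lemma setc_id (x : state V) i : setc x i (x i) = x.
Proof. by apply/ffunP => j; rewrite ffunE; case: eqP => // ->. Qed.

Lemma trap_setP (A : {set state V}) :
  reflect (forall x i, x \in A -> f x i != x i -> flip x i \in A)
          (trap_set f A).
Proof.
apply: (iffP forall_inP) => [tA x i xA fx | tA x xA].
  apply: (implyP (forallP (tA x xA) _)).
  by apply/existsP; exists i; rewrite fx eqxx.
by apply/forallP => y; apply/implyP => /existsP[i /andP[fx /eqP ->]]; apply: tA.
Qed.

Lemma trap_set_connect (A : {set state V}) x y :
  trap_set f A -> connect (transition f) x y -> x \in A -> y \in A.
Proof.
move=> /forall_inP tA /connectP[p + ->]; elim: p x => //= z p IHp x.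
case/andP=> xz zp xA; apply: IHp zp _.
by have /forallP/(_ z)/implyP -> := tA x xA.
Qed.

Lemma connect_setc x i :
  connect (transition f) x (setc x i (f x i)).
Proof.
have [fx|fx] := eqVneq (f x i) (x i); first by rewrite fx setc_id.
apply: connect1; apply/existsP; exists i; rewrite fx /=; apply/eqP.
by congr setc; case: (f x i) (x i) fx => [] [].
Qed.

(** The two increments have the same sign exactly when [f x i] and [x j] agree before the flip. *)
Lemma mem_interaction_graph j s i :
  ((j, s, i) \in interaction_graph f) =
  [exists x, (f (flip x j) i != f x i) && (s == f x i (+) x j)].
Proof.
rewrite inE; apply: eq_existsb => x; rewrite [flip x j j]ffunE eqxx.
by case: s (f _ i) (f x i) (x j) => [] [] [] [].
Qed.

Definition reaches_fixpoint x :=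
  exists2 z, connect (transition f) x z & f z = z.

Lemma reaches_fixpoint_setc x i b :
  f x i = b -> reaches_fixpoint (setc x i b) -> reaches_fixpoint x.
Proof.
move=> <- [z xz fz]; exists z => //.
exact: connect_trans (connect_setc x i) xz.
Qed.

(** An attractor is closed under reachability, so it contains a fixed point, and by minimality
    nothing else. *)
Lemma num_cyclic_attractors_eq0 :
  (forall x, reaches_fixpoint x) -> num_cyclic_attractors f = 0.
Proof.
move=> reach; apply/eqP; rewrite cards_eq0; apply/eqP/setP => A.
rewrite !inE; apply/negP => /andP[/minsetP[/andP[/set0Pn[x xA] tA] minA]].
have [z xz fz] := reach x; rewrite -(minA [set z]) ?cards1 //; last first.
  by rewrite sub1set; apply: trap_set_connect xz xA.
apply/andP; split; first by apply/set0Pn; exists z; rewrite inE.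
by apply/trap_setP => y i; rewrite inE => /eqP->; rewrite fz eqxx.
Qed.

(** A minimal trap set inside [T] cannot be a singleton, since its only state would be fixed. *)
Lemma num_cyclic_attractors_gt0 (T : {set state V}) :
    T != set0 -> trap_set f T -> (forall x, x \in T -> f x != x) ->
  0 < num_cyclic_attractors f.
Proof.
move=> T0 tT noFix.
have [A attrA sAT] : {A | attractor f A & A \subset T}.
  by apply: minset_exists; rewrite T0.
apply/card_gt0P; exists A; rewrite inE /cyclic_attractor attrA /=.
apply/cards1P => -[x defA]; have [/andP[_ /trap_setP tA] _] := minsetP attrA.
have xA : x \in A by rewrite defA inE.
case/eqP: (noFix x (subsetP sAT x xA)); apply/ffunP => i; apply/eqP.
apply/negPn/negP => fx; have := tA x i xA fx; rewrite defA inE.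
by move=> /eqP/ffunP/(_ i); rewrite !ffunE eqxx; case: (x i).
Qed.

End GeneralDynamics.

(** * Counting alternations of a word *)

Definition alternations (k : nat) (h : nat -> bool) : nat :=
  \sum_(i < k) (h i != h i.+1).

(* The extra summand on the left is what makes the induction on k go through. *)
Lemma alternations_copy k (h h' : nat -> bool) :
    h' 0 = h 0 -> (forall j, j < k -> h' j.+1 = h j.+1 \/ h' j.+1 = h' j) ->
  alternations k h' + (h' k != h k) <= alternations k h.
Proof.
rewrite /alternations => h0; elim: k => [|k IHk] copy.
  by rewrite !big_ord0 h0 eqxx.
rewrite !big_ord_recr /=.
have := IHk (fun j jk => copy j (ltnW jk)).
have := copy k (leqnn _).
by case: (h' k) (h k) (h' k.+1) (h k.+1) => [] [] [] [] [] //=; lia.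
Qed.

Lemma alternations_lt k j (h : nat -> bool) :
  j < k -> h j = h j.+1 -> alternations k h < k.
Proof.
move=> jk hj; rewrite /alternations (bigD1 (Ordinal jk)) //= hj eqxx add0n.
rewrite -[X in _ < X]card_ord -sum1_card [X in _ < X](bigD1 (Ordinal jk)) //=.
by rewrite ltnS; apply: leq_sum => i _; apply: leq_b1.
Qed.

Lemma alternationsD k l (h : nat -> bool) :
  alternations (k + l) h =
  alternations k h + alternations l (fun i => h (k + i)).
Proof.
rewrite /alternations big_split_ord /=; congr (_ + _).
by apply: eq_bigr => i _; rewrite addnS.
Qed.

(** * The network and its states as words *)

Section DelayNetwork.

Variable m : nat.

Local Notation vertex := 'I_(m + m).+1.

Definition value_at (x : state vertex) (k : nat) : bool := x (inord k).

Definition of_values (h : nat -> bool) : state vertex := [ffun i => h (val i)].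

Definition register_alternating (x : state vertex) : bool :=
  [forall k : 'I_m, value_at x (m + k) != value_at x (m + k).+1].

Definition register_constant (x : state vertex) : bool :=
  [forall k : 'I_m, value_at x (m + k) == value_at x (m + k).+1].

(* Vertex 0 is the source, vertices 1, ..., m - 1 form the chain of delays, *)
(* and vertices m, ..., m + m form the register.                            *)
Definition delay_network : network vertex := fun x =>
  [ffun i : vertex =>
     if val i == 0 then (if register_constant x then ~~ x i else x i)
     else if (m <= i) && register_alternating x then x i
     else value_at x i.-1].

Lemma value_at_of_values h k : k <= m + m -> value_at (of_values h) k = h k.
Proof. by move=> km; rewrite /value_at ffunE /= inordK. Qed.

Lemma value_at_val x (i : vertex) : value_at x i = x i.
Proof. by rewrite /value_at inord_val. Qed.

Lemma of_valuesK x : of_values (value_at x) = x.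
Proof. by apply/ffunP => i; rewrite ffunE value_at_val. Qed.

Lemma eq_of_values h h' :
  (forall k, k <= m + m -> h k = h' k) -> of_values h = of_values h'.
Proof. by move=> hh; apply/ffunP => i; rewrite !ffunE hh //; have := ltn_ord i. Qed.

Lemma eq_register x y :
    (forall k, m <= k <= m + m -> value_at x k = value_at y k) ->
  register_constant x = register_constant y /\
  register_alternating x = register_alternating y.
Proof.
move=> xy; split; apply: eq_forallb => k; have := ltn_ord k => km;
  by rewrite !xy //; lia.
Qed.

(** * Every state reaches a fixed point *)

Definition prefix_set (h : nat -> bool) (j : nat) (b : bool) : nat -> bool :=
  fun k => if k < j then b else h k.

Local Notation reach h := (reaches_fixpoint delay_network (of_values h)).

Lemma reach_copy_if h j :
    0 < j <= m + m -> (j < m) || ~~ register_alternating (of_values h) ->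
  reach (fun k => if k == j then h j.-1 else h k) -> reach h.
Proof.
move=> jm nAlt rh; apply: (@reaches_fixpoint_setc _ _ _ (inord j) (h j.-1)).
  rewrite ffunE /= inordK; last by lia.
  have -> : (j == 0) = false by lia.
  rewrite leqNgt; case: ltnP nAlt => _ /=; last by move/negPf->;
    rewrite value_at_of_values //; lia.
  by rewrite value_at_of_values //; lia.
congr (reaches_fixpoint _ _): rh; apply/ffunP => i; rewrite !ffunE.
by rewrite -[i == _]val_eqE /= inordK //; lia.
Qed.

(** The register is locked and not constant, so the source is frozen too; its value then fills the
    chain and nothing can move any more. *)
Lemma reach_alternating h :
  0 < m -> register_alternating (of_values h) -> reach h.
Proof.
move=> m0 alt.
have altp j : j <= m -> register_alternating (of_values (prefix_set h j (h 0))).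
  move=> jm; have [k km|_ <- //] :=
    @eq_register (of_values h) (of_values (prefix_set h j (h 0))).
  by rewrite !value_at_of_values ?/prefix_set; [case: ltnP|..]; lia.
have rp j : j < m -> reach (prefix_set h (m - j) (h 0)).
  elim: j => [_ | j IHj jm].
    rewrite subn0; exists (of_values (prefix_set h m (h 0))) => //.
    apply/ffunP => i; rewrite ffunE altp // andbT.
    have -> : register_constant (of_values (prefix_set h m (h 0))) = false.
      apply/negP => /forallP/(_ (Ordinal m0)).
      by have /forallP/(_ (Ordinal m0))/negPf -> := altp _ (leqnn m).
    case: eqP => // i0; case: leqP => // im.
    have i_le := ltn_ord i.
    rewrite value_at_of_values; last by lia.
    by rewrite ffunE /prefix_set im; case: ltnP => //; lia.
  have jm' := ltnW jm.
  move: (IHj jm'); rewrite -(subnSK jm'); set l := m - j.+1 => rl.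
  have l_gt0 : 0 < l by rewrite subn_gt0.
  apply: (@reach_copy_if _ l); [lia | by apply/orP; left; lia |].
  congr (reaches_fixpoint _ _): rl; apply: eq_of_values => k km.
  rewrite /prefix_set /= ltnS ltn_predL l_gt0 leq_eqVlt.
  by case: (eqVneq k l).
have := rp m.-1; rewrite prednK // => /(_ (leqnn _)).
have -> : m - m.-1 = 1 by lia.
by congr (reaches_fixpoint _ _); apply: eq_of_values => -[].
Qed.

Hypothesis m_gt0 : 0 < m.

(** A copy is forbidden only in a locked register, and from there a fixed point is reached anyway;
    so reachability arguments may copy freely. *)
Lemma reach_copy h j :
    0 < j <= m + m ->
  reach (fun k => if k == j then h j.-1 else h k) -> reach h.
Proof.
move=> jm rh.
have [alt | nAlt] := boolP (register_alternating (of_values h)).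
  exact: reach_alternating.
by apply: reach_copy_if rh; rewrite ?nAlt ?orbT.
Qed.

Lemma reach_prefix h j b :
  j <= m + m -> h 0 = b -> reach (prefix_set h j.+1 b) -> reach h.
Proof.
move=> + h0; elim: j => [_ | j IHj jm rh].
  congr (reaches_fixpoint _ _); apply: eq_of_values => -[] //= _.
apply: IHj (ltnW jm) _; apply: (@reach_copy _ j.+1); first by lia.
congr (reaches_fixpoint _ _): rh; apply: eq_of_values => k km.
rewrite /prefix_set /= ltnSn; case: (eqVneq k j.+1) => [->|nk]; first by rewrite ltnSn.
by congr (if _ then _ else _); lia.
Qed.

Lemma reach_toggle h b :
    (forall k, m <= k <= m + m -> h k = h m) ->
  reach (prefix_set h 1 b) -> reach h.
Proof.
move=> cst rh.
have [hb | hb] := eqVneq (h 0) b.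
  by apply: (@reach_prefix h 0 b).
apply: (@reaches_fixpoint_setc _ _ _ ord0 b).
  rewrite ffunE /=; have -> : register_constant (of_values h).
    apply/forallP => k; have := ltn_ord k => km.
    by rewrite !value_at_of_values ?cst ?[h _.+1]cst //; lia.
  by rewrite ffunE /=; case: (h 0) b hb {rh} => [] [].
congr (reaches_fixpoint _ _): rh; apply/ffunP => i; rewrite !ffunE.
by rewrite -[i == _]val_eqE /prefix_set /=; case: (val i).
Qed.

(** The letters of [z] are loaded deepest first: set the source to the letter at position j, flood
    up to j, and continue with the shorter prefix. As j stays below m, the register remains constant
    and the source free. *)
Lemma reach_load z j b :
    j <= m -> (forall k, m <= k <= m + m -> z k = z m) ->
  reach z -> reach (prefix_set z j b).
Proof.
move=> + cst rz; elim: j b => [|j IHj] b jm.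
  by congr (reaches_fixpoint _ _): rz; apply: eq_of_values.
have cstp c : forall k, m <= k <= m + m ->
    prefix_set z j.+1 c k = prefix_set z j.+1 c m.
  move=> k km; rewrite /prefix_set (leq_gtF jm) cst //.
  by case/andP: km => /(leq_trans jm)/leq_gtF ->.
apply: (@reach_toggle _ (z j) (cstp b)).
apply: (@reach_prefix _ j (z j)) => //; first by lia.
congr (reaches_fixpoint _ _): (IHj (z j) (ltnW jm)).
apply: eq_of_values => k km; rewrite /prefix_set [k < j.+1]ltnS.
case: (ltngtP k j) => // [jk | ->] //.
by rewrite ltnS leqn0 (gtn_eqF (leq_ltn_trans (leq0n j) jk)).
Qed.

(* Shifting the whole word to the right, the last vertex moving first. *)
Lemma reach_shift z s :
  reach (fun k => z (k - s.+1)) -> reach (fun k => z (k - s)).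
Proof.
move=> rz.
suff rj j : j <= m + m -> reach (fun k => z (k - s - (j < k))).
  congr (reaches_fixpoint _ _): (rj _ (leqnn _)); apply: eq_of_values => k km.
  by rewrite ltnNge km subn0.
elim: j => [_ | j IHj jm].
  congr (reaches_fixpoint _ _): rz; apply: eq_of_values => k _; congr z.
  by lia.
apply: (@reach_copy _ j.+1); first by lia.
congr (reaches_fixpoint _ _): (IHj (ltnW jm)); apply: eq_of_values => k _.
case: (eqVneq k j.+1) => [->|nk] /=; congr z; lia.
Qed.

Lemma reach_all x : reaches_fixpoint delay_network x.
Proof.
rewrite -(of_valuesK x); set h := value_at x.
apply: (@reach_prefix h (m + m) (h 0)) => //.
(* The word to load alternates at each of the m edges from 0 to m and equals [a] on the whole
   register, so it can be loaded over the constant word [a]. *)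
pose a := h 0; pose z k := if k < m then a (+) odd (m - k) else a.
have cst k : m <= k <= m + m -> z k = z m.
  by case/andP=> mk _; rewrite /z !ltnNge mk leqnn.
suff rz : reach z.
  congr (reaches_fixpoint _ _): (reach_load a (leqnn m) cst rz).
  apply: eq_of_values => k km; rewrite /prefix_set /z ltnS km.
  by case: ltnP.
suff rs s : s <= m -> reach (fun k => z (k - (m - s))).
  have := rs m (leqnn _); rewrite subnn.
  by congr (reaches_fixpoint _ _); apply: eq_of_values => k; rewrite subn0.
elim: s => [_ | s IHs sm].
  (* After m shifts the register holds the letters 0 to m of [z], which alternate fully. *)
  apply: reach_alternating => //; apply/forallP => k.
  have := ltn_ord k => km; rewrite !value_at_of_values; [|lia..].
  rewrite subn0 -addnS !addKn /z km; case: ltnP => km'.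
    by rewrite -[m - k](@prednK _) ?subn_gt0 //= -subnS; case: (a) (odd _) => [] [].
  have -> : m - k = 1 by lia.
  by case: (a).
apply: reach_shift; have -> : (m - s.+1).+1 = m - s by lia.
exact: IHs (ltnW sm).
Qed.

Lemma num_cyclic_attractors_delay : num_cyclic_attractors delay_network = 0.
Proof. exact/num_cyclic_attractors_eq0/reach_all. Qed.

(** * The interaction graph around the chain *)

Lemma value_at_flip x (j : vertex) k :
  k <= m + m -> value_at (flip x j) k = if k == j then ~~ x j else value_at x k.
Proof. by move=> km; rewrite /value_at !ffunE -[_ == j]val_eqE /= inordK. Qed.

Lemma register_flip x (j : vertex) : j < m ->
  register_constant (flip x j) = register_constant x /\
  register_alternating (flip x j) = register_alternating x.
Proof.
move=> jm; apply: eq_register => k /andP[mk km]; rewrite value_at_flip //.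
by rewrite gtn_eqF // (leq_trans jm).
Qed.

Lemma delay_networkE x (i : vertex) :
  delay_network x i =
    if val i == 0 then (if register_constant x then ~~ x i else x i)
    else if (m <= i) && register_alternating x then x i
    else value_at x i.-1.
Proof. by rewrite ffunE. Qed.

Lemma delay_network_chain x (i : vertex) :
  0 < i < m -> delay_network x i = value_at x i.-1.
Proof. by case/andP=> i0 im; rewrite ffunE gtn_eqF // leqNgt im. Qed.

(** A chain vertex reads only its left neighbour, and flipping a chain vertex changes neither
    register test. *)
Lemma delay_network_flip x (j i : vertex) :
    (0 < j < m) || (0 < i < m) -> delay_network (flip x j) i != delay_network x i ->
  val i = j.+1 /\ delay_network x i = x j.
Proof.
move=> ji; have i_le := ltn_ord i.
have [i_chain | i_nchain] := boolP (0 < i < m).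
  rewrite !delay_network_chain // value_at_flip; last by lia.
  case: (eqVneq i.-1 j) => [ij | _]; last by rewrite eqxx.
  by rewrite ij value_at_val => _; split => //=; lia.
have /andP[j0 jm] : 0 < j < m by rewrite (negPf i_nchain) orbF in ji.
have ij : value_at (flip x j) i = value_at x i.
  by rewrite value_at_flip ?ifN //; lia.
rewrite !delay_networkE (register_flip x jm).1 (register_flip x jm).2.
rewrite -[flip x j i]value_at_val ij value_at_val.
case: (val i =P 0) => [_|i0]; first by rewrite eqxx.
case: (_ && _); first by rewrite eqxx.
rewrite value_at_flip; last by lia.
case: (eqVneq i.-1 j) => [ij' | _]; last by rewrite eqxx.
by rewrite ij' value_at_val => _; split => //=; lia.
Qed.

Lemma mem_delay_graph (j i : vertex) s : (0 < j < m) || (0 < i < m) ->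
  ((j, s, i) \in interaction_graph delay_network) = ~~ s && (val i == j.+1).
Proof.
move=> ji; rewrite mem_interaction_graph; apply/existsP/andP.
  case=> x /andP[fx /eqP ->]; have [-> ->] := delay_network_flip ji fx.
  by rewrite eqxx; case: (x j).
case=> /negPf -> /eqP /= ij; have i_le := ltn_ord i.
have jm : j < m by lia.
(* In the zero word the register is not locked, so vertex i copies j even when i = m. *)
pose x := of_values (fun=> false); exists x.
have nAlt : register_alternating x = false.
  apply/negP => /forallP/(_ (Ordinal m_gt0)).
  by rewrite !value_at_of_values ?eqxx //=; lia.
rewrite !delay_networkE (register_flip x jm).2 nAlt andbF ij /=.
rewrite value_at_flip; last by lia.
have -> : (i == 0 :> nat) = false by rewrite ij.
by rewrite eqxx value_at_val !ffunE.
Qed.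

Lemma indegree_delay (i : vertex) : 0 < i < m -> indegree delay_network i = 1.
Proof.
move=> i_chain; have i_le := ltn_ord i.
apply/eqP/cards1P; exists (inord i.-1, false, i); apply/setP => -[[j s] i'].
rewrite in_set inE andbC; case: (eqVneq i' i) => /= [->|ni].
  rewrite mem_delay_graph ?i_chain ?orbT // !xpair_eqE eqxx andbT andbC eqbF_neg.
  by congr (_ && _); rewrite -[j == _]val_eqE /= inordK; lia.
by rewrite xpair_eqE (negPf ni) andbF.
Qed.

Lemma outdegree_delay (j : vertex) : 0 < j < m -> outdegree delay_network j = 1.
Proof.
move=> j_chain; have j_le := ltn_ord j.
apply/eqP/cards1P; exists (j, false, inord j.+1); apply/setP => -[[j' s] i].
rewrite in_set inE andbC; case: (eqVneq j' j) => /= [->|nj].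
  rewrite mem_delay_graph ?j_chain // !xpair_eqE eqxx /= eqbF_neg.
  by congr (_ && _); rewrite -[i == _]val_eqE /= inordK; lia.
by rewrite !xpair_eqE (negPf nj).
Qed.

Lemma positive_loop_delay (v : vertex) :
  0 < v < m -> ~~ positive_loop delay_network v.
Proof. by move=> vm; rewrite /positive_loop mem_delay_graph ?vm //=; lia. Qed.

Lemma arc_delay (j i : vertex) :
  0 < j < m -> val i = j.+1 -> Defs.arc delay_network j i.
Proof.
move=> jm ij; apply/existsP; exists false.
by rewrite mem_delay_graph ?jm // ij eqxx.
Qed.

(** * Elimination of a chain vertex *)

Section EliminateDelay.

Variable v : vertex.
Hypothesis v_chain : 0 < v < m.

Let v_le : v <= m + m. Proof. by rewrite -ltnS. Qed.

Local Notation lift := (lift_state delay_network false).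

Lemma lift_delay (y : state (remaining v)) (i : remaining v) :
  lift y (val i) = y i.
Proof. by rewrite !ffunE (negPf (valP i)) valK. Qed.

Lemma lift_delay_eliminated (y : state (remaining v)) :
  value_at (lift y) v = value_at (lift y) v.-1.
Proof.
rewrite value_at_val [LHS]ffunE eqxx delay_network_chain //.
rewrite /value_at /lift_state /replace !ffunE -!(inj_eq val_inj) /= inordK; last by lia.
by have -> : (v.-1 == v) = false by lia.
Qed.

(** A chain vertex has no loop, so both lifts agree and elimination is plain substitution. *)
Lemma lift_delay_true (y : state (remaining v)) :
  lift_state delay_network true y = lift y.
Proof.
apply/ffunP => i; rewrite [LHS]ffunE [RHS]ffunE.
case: (eqVneq i v) => [_ | iv]; last by rewrite !ffunE insubT.
rewrite !delay_network_chain //.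
rewrite /value_at !ffunE -!(inj_eq val_inj) /= inordK; last by lia.
have -> : (v.-1 == v) = false by lia.
by rewrite insubT // -(inj_eq val_inj) /= inordK; lia.
Qed.

Lemma eliminate_delayE y (i : remaining v) :
  eliminate delay_network v y i = delay_network (lift y) (val i).
Proof. by rewrite ffunE lift_delay_true andbb orbb if_same. Qed.

Definition few_alternations : {set state (remaining v)} :=
  [set y | alternations (m + m) (value_at (lift y)) < m].

Lemma few_alternations_neq0 : few_alternations != set0.
Proof.
pose y : state (remaining v) := [ffun=> false].
apply/set0Pn; exists y; rewrite inE /alternations big1 // => k _.
suff lift0 : forall i, lift y i = false by rewrite /value_at !lift0.
move=> i; have [->|iv] := eqVneq i v.
  rewrite -(value_at_val (lift _) v) lift_delay_eliminated /value_at.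
  have iv : inord v.-1 != v by rewrite -(inj_eq val_inj) /= inordK; lia.
  by rewrite -[inord _]/(val (Sub (inord v.-1) iv : remaining v)) lift_delay ffunE.
by rewrite -[i]/(val (Sub i iv : remaining v)) lift_delay ffunE.
Qed.

(** A locked register alone has m alternations, so here it is unlocked. Fixedness then propagates
    equality along every edge, the one into [v] included, and a constant register makes the source
    toggle. *)
Lemma few_alternations_unfixed y :
  y \in few_alternations -> eliminate delay_network v y != y.
Proof.
rewrite inE => few; apply/eqP => fix_y; set x := lift y in few.
have fix_x (i : vertex) : i != v -> delay_network x i = x i.
  move=> iv; rewrite -[i]/(val (Sub i iv : remaining v)) -eliminate_delayE.
  by rewrite fix_y lift_delay.
have nAlt : register_alternating x = false.
  apply/negP => /forallP alt; move: few; rewrite alternationsD ltnNge.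
  rewrite (leq_trans _ (leq_addl _ _)) // /alternations.
  rewrite (eq_bigr (fun=> 1)) ?sum1_card ?card_ord // => k _.
  by rewrite addnS alt.
have cst k : k < m + m -> value_at x k = value_at x k.+1.
  move=> km; have [kv|kv] := eqVneq k.+1 v.
    by rewrite kv lift_delay_eliminated -kv.
  have := fix_x (inord k.+1); rewrite -(inj_eq val_inj) ffunE /= inordK // kv.
  by rewrite nAlt andbF /= => ->.
have := fix_x ord0; rewrite ffunE /= => fix0.
have : register_constant x.
  by apply/forallP => k; rewrite cst //; have := ltn_ord k; lia.
have v0 : ord0 != v by rewrite -(inj_eq val_inj) /=; lia.
by move=> xc; have := fix0 v0; rewrite xc; case: (x ord0).
Qed.

Lemma trap_few_alternations : trap_set (eliminate delay_network v) few_alternations.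
Proof.
apply/trap_setP => y i; rewrite eliminate_delayE !inE => few fi.
set x := lift y in few fi; set x' := lift (flip y i).
have x'E k : k <= m + m -> k != v -> k != val i -> value_at x' k = value_at x k.
  move=> km kv ki; have kv' : inord k != v by rewrite -(inj_eq val_inj) /= inordK.
  rewrite /value_at -[inord k]/(val (Sub (inord k) kv' : remaining v)) !lift_delay.
  rewrite !ffunE ifN // -(inj_eq val_inj) -(inj_eq val_inj) /= inordK //.
have x'v : value_at x' v = value_at x' v.-1 by apply: lift_delay_eliminated.
have x'i : value_at x' (val i) = delay_network x (val i).
  rewrite value_at_val lift_delay /flip ffunE eqxx.
  by move: fi; rewrite -(lift_delay y) -/x; case: (x _) (delay_network _ _) => [] [].
have i_le := ltn_ord (val i).
have [i0 | i0] := eqVneq (nat_of_ord (val i)) 0.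
  have cst : register_constant x.
    move: fi; rewrite ffunE /= i0 eqxx; case: register_constant => //.
    by rewrite -(lift_delay y) eqxx.
  (* The source moves only if the register is constant, so all alternations lie on the first m
     edges, of which the edge into [v] has none. *)
  rewrite alternationsD [X in _ + X]big1 ?addn0.
    by apply: (@alternations_lt _ v.-1); rewrite ?prednK ?x'v //; lia.
  move=> k _; rewrite addnS !x'E; [|have := ltn_ord k; lia..].
  by move/forallP: cst => /(_ k)/eqP ->; rewrite eqxx.
apply: leq_ltn_trans few.
apply: leq_trans (leq_addr _ _) (alternations_copy _ _).
  by apply: x'E; lia.
(* Updating v - 1 also changes the lifted letter at [v]; this is a copy of the updated left
   neighbour, as [alternations_copy] allows. *)
move=> j jm; have [jv|jv] := eqVneq j.+1 v.
  by right; rewrite jv x'v -jv.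
have [ji|ji] := eqVneq j.+1 (val i); last by left; apply: x'E.
rewrite ji x'i.
have := fi; rewrite -(lift_delay y) -/x ffunE (negPf i0).
case: (_ && _); first by rewrite eqxx.
move=> _; right; rewrite -ji /=.
have [jv'|jv'] := eqVneq j v; last by rewrite x'E //; lia.
rewrite jv' x'v /x lift_delay_eliminated x'E //; lia.
Qed.

Lemma num_cyclic_attractors_eliminate :
  0 < num_cyclic_attractors (eliminate delay_network v).
Proof.
exact: num_cyclic_attractors_gt0 few_alternations_neq0 trap_few_alternations
  few_alternations_unfixed.
Qed.

End EliminateDelay.

End DelayNetwork.

Theorem theorem4p3 (n : nat) (n_ge1 : 1 <= n) :
  exists (V : finType) (f : network V) (v0 : V) (p : seq V),
    [/\ is_graph_path f n v0 p,
        forall v, v \in v0 :: p -> indegree f v = 1 /\ outdegree f v = 1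
      & forall v, v \in v0 :: p ->
          ~~ positive_loop f v /\
          num_cyclic_attractors f < num_cyclic_attractors (eliminate f v)].
Proof.
(* The chain 1, ..., m - 1 then has n + 1 vertices, hence n edges. *)
set m := n.+2; have m_gt0 : 0 < m by [].
pose p k : seq 'I_(m + m).+1 := [seq inord i | i <- iota 2 k].
have inordE i : i <= n.+1 -> nat_of_ord (inord i : 'I_(m + m).+1) = i.
  by move=> im; rewrite inordK //; lia.
have chain v : v \in inord 1 :: p n -> 0 < v < m.
  rewrite -[_ :: _]/[seq inord i | i <- iota 1 n.+1] => /mapP[i].
  by rewrite mem_iota => im ->; rewrite inordE; lia.
exists 'I_(m + m).+1, (@delay_network m), (inord 1), (p n); split.
- apply/and3P; split; first by rewrite size_map size_iota.
    rewrite /p path_map.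
    suff arcs k j : 0 < j -> j + k <= n.+1 ->
      path (relpre inord (Defs.arc (@delay_network m))) j (iota j.+1 k).
      exact: arcs.
    elim: k j => //= k IHk j j0 jk; rewrite IHk // ?addSnnS // andbT.
    by apply: arc_delay; rewrite //= !inordE; lia.
  rewrite -[_ :: _]/[seq inord i | i <- iota 1 n.+1] map_inj_in_uniq ?iota_uniq //.
  move=> i j; rewrite !mem_iota => im jm /(congr1 val) /=.
  by rewrite !inordE; lia.
- by move=> v /chain vm; rewrite indegree_delay ?outdegree_delay.
move=> v /chain vm; split; first exact: positive_loop_delay.
by rewrite num_cyclic_attractors_delay // num_cyclic_attractors_eliminate.
Qed.
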